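(* Let $F$ be a field of characteristic $3$, let $G$ be an abelian group, and let $\Gamma$ be a $G$-grading on the superalgebra $B(1,2)$ over $F$. Then there is an element $g\in G$ such that $\Gamma$ is isomorphic to $\Gamma(G,g)$. Moreover, for $g,h\in G$, $\Gamma(G,g)$ is isomorphic to $\Gamma(G,h)$ if and only if either $g=h$ or $g=-h$.
   Context: Gradings. A grading by an abelian group $G$ (written additively) on an algebra $\mathcal A$ is a decomposition $\mathcal A=\bigoplus_{g\in G}\mathcal A^g$ into subspaces with $\mathcal A^g\mathcal A^h\subseteq\mathcal A^{g+h}$. A superalgebra is a $\mathbb{Z}_2$-graded algebra $\mathcal A=\mathcal A_{\bar0}\oplus\mathcal A_{\bar1}$ (this is the main grading). A grading on the superalgebra $\mathcal A$ is a group grading on the algebra $\mathcal A$ such that $\mathcal A^g=(\mathcal A^g\cap\mathcal A_{\bar0})\oplus(\mathcal A^g\cap\mathcal A_{\bar1})$ for all $g$. Two $G$-gradings are isomorphic if there is an isomorphism of superalgebras (an algebra isomorphism preserving the main grading) which, for every $g\in G$, maps the component of degree $g$ of the first onto the component of degree $g$ of the second. The superalgebra $B(1,2)$. Let $V$ be a $2$-dimensional vector space over a field $F$ of characteristic $3$ with a nondegenerate alternating form $(\cdot,\cdot)$. Then $B(1,2)=F1\oplus V$, with $B(1,2)_{\bar0}=F1$, $B(1,2)_{\bar1}=V$, and multiplication $1x=x1=x$ for all $x$ and $uv=(u,v)1$ for $u,v\in V$. The grading $\Gamma(G,g)$. Fix a basis $\{u,v\}$ of $V$ with $(u,v)=1$.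 For $g\in G$, $\Gamma(G,g)$ is the $G$-grading on $B(1,2)$ determined by $\deg(1)=0$, $\deg(u)=g$, $\deg(v)=-g$. Up to isomorphism it does not depend on the choice of the basis. *)

(* Defs.v *)
From HB Require Import structures.
From mathcomp Require Export all_boot all_order all_algebra.

Set Implicit Arguments.
Unset Strict Implicit.
Unset Printing Implicit Defensive.

Import GRing.Theory.
Local Open Scope ring_scope.

(* Algebras are not assumed associative or unital, so a multiplication is just
   a bilinear map.  G may be infinite; since A has finite dimension, A is the
   sum of all components iff it is the sum of finitely many of them, and the
   sum is direct iff all its finite subsums are. *)
Definition is_grading (F : fieldType) (G : zmodType) (A : vectType F)
    (mul : A -> A -> A) (Gam : G -> {vspace A}) : Prop :=
  [/\ exists s : seq G, (\sum_(g <- s) Gam g)%VS = fullv,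
      forall s : seq G, uniq s -> directv (\sum_(g <- s) Gam g)%VS
    & forall (g h : G) (x y : A),
        x \in Gam g -> y \in Gam h -> mul x y \in Gam (g + h)].

Record superalgebra (F : fieldType) := Superalgebra {
  salg_sort :> vectType F;
  salg_mul : {bilinear salg_sort -> salg_sort -> salg_sort};
  salg_par : 'Z_2 -> {vspace salg_sort};
  salg_parP : is_grading salg_mul salg_par
}.

(* The sum is automatically direct, as the even and odd parts of A are in
   direct sum. *)
Definition is_super_grading (F : fieldType) (G : zmodType)
    (A : superalgebra F) (Gam : G -> {vspace A}) : Prop :=
  is_grading (salg_mul A) Gam /\
  forall g : G,
    Gam g = ((Gam g :&: salg_par A 0%R) + (Gam g :&: salg_par A 1%R))%VS.

Definition isomorphic_gradings (F : fieldType) (G : zmodType)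
    (A B : superalgebra F) (Gam : G -> {vspace A}) (Del : G -> {vspace B}) :
    Prop :=
  exists f : 'Hom(A, B),
    [/\ bijective f,
        forall x y : A, f (salg_mul A x y) = salg_mul B (f x) (f y),
        forall i : 'Z_2, (f @: salg_par A i)%VS = salg_par B i
      & forall g : G, (f @: Gam g)%VS = Del g].

Definition alternating (F : fieldType) (V : vectType F) (b : {biscalar V}) :
    Prop :=
  forall x : V, b x x = 0.

Definition nondegenerate_form (F : fieldType) (V : vectType F)
    (b : {biscalar V}) : Prop :=
  forall x : V, (forall y : V, b x y = 0) -> x = 0.

Lemma directv_seq (F : fieldType) (A : vectType F) (I : eqType)
    (U : I -> {vspace A}) :
  (forall i s, i \notin s -> (U i :&: \sum_(j <- s) U j = 0)%VS) ->
  forall s, uniq s -> directv (\sum_(i <- s) U i)%VS.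
Proof.
move=> dxU; elim=> [|i s IHs] /=.
  by move=> _; rewrite directvE /= !big_nil dimv0.
case/andP=> iNs /IHs; rewrite !directvE /= !big_cons => /eqP <-.
by rewrite dimv_disjoint_sum // dxU.
Qed.

Lemma span_ind (F : fieldType) (A : vectType F) (s : seq A) (P : pred A) :
  P 0 -> (forall k x y, P x -> P y -> P (k *: x + y)) ->
  {in s, forall x, P x} -> forall x, x \in <<s>>%VS -> P x.
Proof.
move=> P0 PL; elim: s => [|z s IHs] Ps x.
  by rewrite span_nil memv0 => /eqP->.
rewrite span_cons => /memv_addP[_ /vlineP[k ->] [y ys ->]].
apply: PL; first by rewrite Ps ?mem_head.
by apply: IHs ys => w ws; rewrite Ps // inE ws orbT.
Qed.

Section B12.
Variables (F : fieldType) (V : vectType F) (b : {biscalar V}).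

(* The pair (a, x) stands for the element a1 + x of F1 (+) V. *)
Definition B12_mul (x y : F^o * V) : F^o * V :=
  (x.1 * y.1 + b x.2 y.2, x.1 *: y.2 + y.1 *: x.2).

Definition B12_one : F^o * V := (1, 0).

(* The copy of V in F1 (+) V is the set of pairs with first component 0. *)
Definition B12_par (i : 'Z_2) : {vspace F^o * V} :=
  if i == 0 then <[B12_one]>%VS else lker (linfun fst).

Lemma B12_mul_bilinear : bilinear_for *:%R *:%R B12_mul.
Proof.
split=> [z|z] k x y; rewrite /B12_mul; congr pair => /=.
- rewrite mulrDl linearPl /= scalerDr addrACA; congr (_ + _).
  by rewrite /GRing.scale /= mulrA.
- rewrite scalerDl [z.1 *: (_ + _)]scalerDr [k *: (_ + _)]scalerDr addrACA.
  by rewrite !scalerA [z.1 * k]mulrC.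
- rewrite mulrDr linearPr /= scalerDr addrACA; congr (_ + _).
  by rewrite /GRing.scale /= mulrCA.
- rewrite [z.1 *: (_ + _)]scalerDr scalerDl [k *: (_ + _)]scalerDr addrACA.
  by rewrite !scalerA [z.1 * k]mulrC.
Qed.

HB.instance Definition _ := bilinear_isBilinear.Build F (F^o * V)%type
  (F^o * V)%type (F^o * V)%type *:%R *:%R B12_mul B12_mul_bilinear.

Lemma mem_B12_par (i : 'Z_2) (x : F^o * V) :
  (x \in B12_par i) = if i == 0 then x.2 == 0 else x.1 == 0.
Proof.
rewrite /B12_par; case: eqP => _; last by rewrite memv_ker lfunE.
apply/vlineP/eqP => [[k ->]|x20]; first by rewrite /= scaler0.
exists x.1; case: x x20 => a y /= ->.
by congr pair; rewrite /= ?scaler0 // /GRing.scale /= mulr1.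
Qed.

Lemma B12_parP : is_grading B12_mul B12_par.
Proof.
split.
- exists [:: 0; 1]; apply/eqP; rewrite eqEsubv subvf; apply/subvP => -[a y] _.
  rewrite !big_cons big_nil addv0.
  have -> : (a, y) = (a, 0) + (0, y) :> F^o * V.
    by congr pair; rewrite /= ?addr0 ?add0r.
  by apply: memv_add; rewrite mem_B12_par /=.
- apply: directv_seq => i s iNs; apply/eqP; rewrite -subv0.
  have sub : (\sum_(j <- s) B12_par j <= B12_par (i + 1)%R)%VS.
    elim: s iNs => [|j s IHs]; first by rewrite big_nil sub0v.
    rewrite inE negb_or eq_sym big_cons => /andP[ji /IHs sub].
    rewrite subv_add sub andbT.
    by case: i ji {IHs sub} => [[|[|?]] ?] //; case: j => [[|[|?]] ?].
  apply: (subv_trans (capvS (subvv (B12_par i)) sub)); apply/subvP => -[a y].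
  rewrite memv_cap !mem_B12_par memv0 /=.
  by case: i {iNs sub} => [[|[|?]] ?] //= /andP[/eqP-> /eqP->].
- move=> i j [a x] [c y]; rewrite !mem_B12_par.
  case: i => [[|[|?]] ?] //; case: j => [[|[|?]] ?] //= /eqP-> /eqP->;
  by rewrite /B12_mul /= ?scale0r ?scaler0 ?linear0l ?linear0r ?mul0r ?mulr0 ?addr0.
Qed.

Definition B12 : superalgebra F := Superalgebra B12_parP.

(* The component of degree h is spanned by those of the homogeneous basis
   elements 1, u, v that have degree h. *)
Definition Gamma (G : zmodType) (u v : V) (g h : G) : {vspace B12} :=
  <<[seq e.1 | e <- [:: (B12_one, 0); ((0, u), g); ((0, v), - g)]%R
             & e.2 == h]>>%VS.

Lemma mem_Gamma (G : zmodType) (u v : V) (g h : G) (x : F^o * V) :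
    alternating b -> basis_of {:V} [:: u; v] -> b u v = 1 ->
  (x \in Gamma u v g h) = [&& (x.1 == 0) || (0 == h),
    (b x.2 v == 0) || (g == h) & (b u x.2 == 0) || (- g == h)].
Proof.
move=> b_alt /span_basis uvV b_uv.
have xE : x = x.1 *: B12_one + b x.2 v *: (0, u) + b u x.2 *: (0, v).
  case: x => a y; have: y \in <<[:: u; v]>>%VS by rewrite uvV memvf.
  rewrite span_cons span_seq1.
  case/memv_addP=> _ /vlineP[k ->] [_ /vlineP[l ->] ->] /=.
  rewrite linearDl linearD !linearZl_LR !linearZ /= !b_alt b_uv.
  rewrite !(mulr0, mulr1, addr0, add0r).
  congr pair; rewrite /= ?scaler0 ?addr0 ?add0r //.
  by rewrite /GRing.scale /= mulr1.
apply/idP/idP.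
  move: x {xE}; apply: span_ind => [|k w z|w /mapP[e]].
  - by rewrite /= linear0l linear0r eqxx.
  - move=> /and3P[w1 w2 w3] /and3P[z1 z2 z3]; rewrite /= linearPl linearPr /=.
    by apply/and3P; split; [move: w1 z1|move: w2 z2|move: w3 z3];
       case: (_ == _ :> G); rewrite ?orbT // !orbF => /eqP-> /eqP->;
       rewrite ?(scaler0, mulr0) addr0.
  rewrite mem_filter !inE => /andP[/eqP<- /or3P[] /eqP->] -> /=;
  by rewrite ?(b_alt, linear0l, linear0r, eqxx, orbT).
case/and3P=> c1 c2 c3.
rewrite xE; apply: memvD; first apply: memvD.
- case/predU1P: c1 => [->|/eqP h0]; first by rewrite scale0r mem0v.
  by apply/memvZ/memv_span; rewrite /= h0 eqxx inE eqxx.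
- case/predU1P: c2 => [->|gh]; first by rewrite scale0r mem0v.
  apply/memvZ/memv_span/mapP; exists ((0, u), g) => //.
  by rewrite mem_filter /= gh !inE eqxx orbT.
- case/predU1P: c3 => [->|gh]; first by rewrite scale0r mem0v.
  apply/memvZ/memv_span/mapP; exists ((0, v), - g) => //.
  by rewrite mem_filter /= gh !inE eqxx !orbT.
Qed.

Lemma Gamma_is_super_grading (G : zmodType) (u v : V) (g : G) :
    alternating b -> basis_of {:V} [:: u; v] -> b u v = 1 ->
  is_super_grading (Gamma u v g).
Proof.
move=> b_alt uvV b_uv; have memG := mem_Gamma g _ _ b_alt uvV b_uv.
have bE x y : b x y = b x v * b u y - b u x * b y v.
  have: x \in <<[:: u; v]>>%VS by rewrite (span_basis uvV) memvf.
  rewrite span_cons span_seq1.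
  case/memv_addP=> _ /vlineP[k ->] [_ /vlineP[l ->] ->] /=.
  have b_vy : b v y = - b y v.
    apply/eqP; rewrite -addr_eq0; have := b_alt (v + y).
    by rewrite linearDl !linearD /= !b_alt add0r addr0 => ->.
  rewrite !linearDl !linearD !linearZl_LR !linearZ /= !b_alt b_uv b_vy.
  by rewrite !(mulr0, mulr1, addr0, add0r) mulrN.
split; first split.
- exists [:: 0; g; - g]; apply/eqP; rewrite eqEsubv subvf.
  apply/subvP => -[a y] _; rewrite !big_cons big_nil addv0.
  have: y \in <<[:: u; v]>>%VS by rewrite (span_basis uvV) memvf.
  rewrite span_cons span_seq1.
  case/memv_addP=> _ /vlineP[k ->] [_ /vlineP[l ->] ->].
  have -> : (a, k *: u + l *: v) =
      (a, 0) + ((0, k *: u) + (0, l *: v)) :> F^o * V.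
    by congr pair; rewrite /= ?addr0 ?add0r.
  by apply: memv_add; last apply: memv_add; rewrite memG /= ?linear0l ?linear0r
    ?linearZl_LR ?linearZ /= ?b_alt ?mulr0 !eqxx ?orbT.
- apply: directv_seq => i s iNs; apply/eqP; rewrite -subv0; apply/subvP => x.
  rewrite memv_cap memv0 memG => /andP[/and3P[x1 x2 x3] xs].
  have : [&& (x.1 == 0) || (0 != i), (b x.2 v == 0) || (g != i)
           & (b u x.2 == 0) || (- g != i)].
    elim: s iNs x {x1 x2 x3} xs => [|j s IHs] iNs x.
      by rewrite big_nil memv0 => /eqP-> /=; rewrite linear0l linear0r eqxx.
    move: iNs; rewrite inE negb_or big_cons => /andP[ij iNs].
    case/memv_addP=> y + [z /(IHs iNs)/and3P[z1 z2 z3] ->].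
    rewrite memG => /and3P[y1 y2 y3]; rewrite /= linearDl linearD /=.
    have jP d : d == j -> d != i by move/eqP->; rewrite eq_sym.
    by apply/and3P; split; [move: y1 z1|move: y2 z2|move: y3 z3];
       case/orP=> [/eqP->|/jP->]; rewrite ?orbT // add0r.
  case/and3P=> [z1 z2 z3].
  have x10 : x.1 = 0 by case/orP: x1 z1 => [/eqP //|->]; rewrite orbF => /eqP.
  have x20 : b x.2 v = 0 by case/orP: x2 z2 => [/eqP //|->]; rewrite orbF => /eqP.
  have x30 : b u x.2 = 0 by case/orP: x3 z3 => [/eqP //|->]; rewrite orbF => /eqP.
  move: x10 x20 x30; case: x {xs x1 x2 x3 z1 z2 z3} => a y /= ->.
  have: y \in <<[:: u; v]>>%VS by rewrite (span_basis uvV) memvf.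
  rewrite span_cons span_seq1.
  case/memv_addP=> _ /vlineP[k ->] [_ /vlineP[l ->] ->].
  rewrite linearDl linearD !linearZl_LR !linearZ /= !b_alt b_uv.
  by rewrite !(mulr0, mulr1, addr0, add0r) => -> ->; rewrite !scale0r addr0.
- move=> i j x y; rewrite !memG => /and3P[x1 x2 x3] /and3P[y1 y2 y3] /=.
  have deg (p q : F) (d e : G) : (p == 0) || (d == i) -> (q == 0) || (e == j) ->
      (p * q == 0) || (d + e == i + j).
    by case/orP=> /eqP-> => [|/orP[] /eqP->]; rewrite ?mul0r ?mulr0 eqxx ?orbT.
  have add0 (p q : F) c : (p == 0) || c -> (q == 0) || c -> (p + q == 0) || c.
    by case: c; rewrite ?orbT // !orbF => /eqP-> /eqP->; rewrite addr0.
  rewrite linearDl linearD !linearZl_LR !linearZ /= [b x.2 y.2]bE -mulNr.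
  apply/and3P; split.
  + apply: (@add0); first by have := deg _ _ _ _ x1 y1; rewrite addr0.
    apply: (@add0); first by have := deg _ _ _ _ x2 y3; rewrite subrr.
    by rewrite mulNr oppr_eq0; have := deg _ _ _ _ x3 y2; rewrite addNr.
  + apply: (@add0); first by have := deg _ _ _ _ x1 y2; rewrite add0r.
    by rewrite mulrC; have := deg _ _ _ _ x2 y1; rewrite addr0.
  + apply: (@add0); first by have := deg _ _ _ _ x1 y3; rewrite add0r.
    by rewrite mulrC; have := deg _ _ _ _ x3 y1; rewrite addr0.
move=> i; apply/eqP; rewrite eqEsubv; apply/andP; split; last first.
  by rewrite subv_add !capvSl.
apply/subvP => -[a y]; rewrite memG /= => /and3P[x1 x2 x3].
have -> : (a, y) = (a, 0) + (0, y) :> F^o * V.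
  by congr pair; rewrite /= ?addr0 ?add0r.
by apply: memv_add; rewrite memv_cap memG mem_B12_par /= ?linear0l ?linear0r
  ?eqxx ?x1 ?x2 ?x3.
Qed.

End B12.

(* Main.v *)
(** Some pair of homogeneous odd vectors [x], [y] has [b x y = 1], since the
    homogeneous odd vectors span [V].  Their product [1] is then homogeneous and
    idempotent, so of degree 0, and the degrees of [x] and [y] are opposite.
    Thus the given grading contains [Gamma x y g] componentwise, which forces
    equality; and the symplectic change of basis from [x, y] to [u, v] carries
    it to [Gamma u v g].  The symplectic map [u -> v], [v -> - u] exchanges
    [g] and [- g]; conversely an isomorphism sends [u] to a nonzero odd vector
    of degree [g], but the odd part of [Gamma u v h] lives in degrees [h] and
    [- h]. *)
From HB Require Import structures.
Require Import Defs.
Import GRing.Theory.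
Local Open Scope ring_scope.

Set Implicit Arguments.
Unset Strict Implicit.
Unset Printing Implicit Defensive.

(** * Comparison of two gradings of one algebra *)

Lemma sumv_seq_sup (F : fieldType) (A : vectType F) (I : eqType)
    (U : I -> {vspace A}) (s : seq I) (i : I) :
  i \in s -> (U i <= \sum_(j <- s) U j)%VS.
Proof. by move=> si; rewrite (big_rem i) //= addvSl. Qed.

Lemma sumv_seqS (F : fieldType) (A : vectType F) (I : eqType)
    (U : I -> {vspace A}) (s t : seq I) :
  {subset s <= t} -> (\sum_(j <- s) U j <= \sum_(j <- t) U j)%VS.
Proof.
move=> st; rewrite big_seq; elim/big_rec: _ => [|i W si WU]; first exact: sub0v.
by rewrite subv_add WU sumv_seq_sup ?st.
Qed.

Section Gradings.
Variables (F : fieldType) (G : zmodType) (A : vectType F) (mul : A -> A -> A).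
Implicit Types Gam Del : G -> {vspace A}.

Lemma grading_degree_unique Gam g h x :
  is_grading mul Gam -> x != 0 -> x \in Gam g -> x \in Gam h -> g = h.
Proof.
case=> _ dxGam _ x0 xg xh; apply/eqP; apply: contraNT x0 => gh.
have dx : (Gam g :&: Gam h = 0)%VS.
  apply/directv_addP; have := dxGam [:: g; h]; rewrite /= inE gh !directvE /=.
  by rewrite !big_cons !big_nil addv0 addn0 => ->.
by rewrite -memv0 -dx memv_cap xg.
Qed.

(** A dimension count over finitely many degrees, including [g], whose [Del]-components span: the
    dimensions of [Del] add up to that of [A], those of [Gam] to at most that, so no term can be
    strictly larger. *)
Lemma grading_sub_eq Gam Del :
  is_grading mul Gam -> is_grading mul Del ->
  (forall g, (Del g <= Gam g)%VS) -> forall g, Gam g = Del g.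
Proof.
move=> [_ dxGam _] [[s sDel] dxDel _] sub g.
pose t := undup (g :: s).
have ut : uniq t by exact: undup_uniq.
have gt : g \in t by rewrite mem_undup mem_head.
have Delt : (\sum_(h <- t) Del h)%VS = fullv.
  apply/eqP; rewrite eqEsubv subvf -sDel; apply: sumv_seqS => h hs.
  by rewrite mem_undup inE hs orbT.
have := dimvS (subvf (\sum_(h <- t) Gam h)%VS).
rewrite -Delt; have := dxGam t ut; have := dxDel t ut.
rewrite !directvE /= => /eqP-> /eqP->; rewrite !(bigD1_seq g) //= => le_dim.
apply/esym/eqP; rewrite eqEdim sub /=.
have le_rest : (\sum_(h <- t | h != g) \dim (Del h)
               <= \sum_(h <- t | h != g) \dim (Gam h))%N.
  by apply: leq_sum => h _; apply: dimvS.
by rewrite -(leq_add2r (\sum_(h <- t | h != g) \dim (Gam h))%N)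
  (leq_trans le_dim) // leq_add2l.
Qed.

End Gradings.

(** * Symplectic bases of the plane and their coordinates *)

Section B12Gradings.
Variables (F : fieldType) (V : vectType F) (b : {biscalar V}).
Hypotheses (dimV : \dim {:V} = 2%N) (b_alt : alternating b).
Implicit Types x y u v w : V.

Lemma alternating_anti x y : b y x = - b x y.
Proof.
apply/eqP; rewrite -addr_eq0 addrC; have := b_alt (x + y).
by rewrite linearDl !linearD /= !b_alt add0r addr0 => ->.
Qed.

Lemma symplectic_basis x y : b x y = 1 -> basis_of {:V} [:: x; y].
Proof.
move=> bxy; rewrite basisEfree subvf dimV !andbT.
have -> : free [:: x; y]; last by [].
have y0 : y != 0.
  by apply/eqP=> y0; move: bxy; rewrite y0 linear0r => /eqP; rewrite eq_sym oner_eq0.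
rewrite free_cons seq1_free y0 andbT span_seq1; apply/negP => /vlineP[k xE].
by move: bxy; rewrite xE linearZl_LR /= b_alt mulr0 => /eqP; rewrite eq_sym oner_eq0.
Qed.

Lemma symplectic_expansion x y w : b x y = 1 -> w = b w y *: x + b x w *: y.
Proof.
move=> bxy; have : w \in <<[:: x; y]>>%VS.
  by rewrite (span_basis (symplectic_basis bxy)) memvf.
rewrite span_cons span_seq1 => /memv_addP[_ /vlineP[k ->] [_ /vlineP[l ->] ->]].
rewrite linearDl linearD !linearZl_LR !linearZ /= !b_alt bxy.
by rewrite !(mulr0, mulr1, addr0, add0r).
Qed.

(** The form is the same determinant of coordinates in every symplectic basis; this makes
    [B12_change] multiplicative. *)
Lemma form_expansion x y w t :
  b x y = 1 -> b w t = b w y * b x t - b x w * b t y.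
Proof.
move=> bxy; rewrite {1}(symplectic_expansion w bxy).
by rewrite linearDl !linearZl_LR /= (alternating_anti t y) mulrN.
Qed.

(** * Automorphisms induced by symplectic changes of basis *)

Section ChangeOfBasis.
Variables x y u v : V.

(** When [b x y = 1], the scalars [b w y] and [b x w] are the coordinates of [w] in the basis
    [x, y], so this map fixes 1 and sends [x] to [u] and [y] to [v]. *)
Definition B12_change (z : F^o * V) : F^o * V :=
  (z.1, b z.2 y *: u + b x z.2 *: v).

Lemma B12_change_linear : linear B12_change.
Proof.
move=> k z w; rewrite /B12_change; congr pair => /=.
rewrite linearPl linearPr /= !scalerDl scalerDr !scalerA.
by rewrite addrACA.
Qed.

HB.instance Definition _ :=
  GRing.isLinear.Build F (F^o * V)%type (F^o * V)%type *:%R B12_change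
    B12_change_linear.

End ChangeOfBasis.

(** Coordinates survive the change of basis. Products and membership in [Gamma] depend on them and
    the scalar part only, so both are transported by rewriting. *)
Lemma form_change x y u v w :
  b u v = 1 ->
  b (b w y *: u + b x w *: v) v = b w y /\ b u (b w y *: u + b x w *: v) = b x w.
Proof.
move=> buv; rewrite linearDl linearD !linearZl_LR !linearZ /= !b_alt buv.
by rewrite !(mulr0, mulr1, addr0, add0r).
Qed.

Lemma B12_changeK x y u v : b x y = 1 -> b u v = 1 ->
  cancel (B12_change x y u v) (B12_change u v x y).
Proof.
move=> bxy buv [a w]; rewrite /B12_change /=.
by have [-> ->] := form_change x y w buv; rewrite -symplectic_expansion.
Qed.

Lemma B12_changeM x y u v : b x y = 1 -> b u v = 1 ->
  {morph B12_change x y u v : z w / B12_mul b z w}.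
Proof.
move=> bxy buv [a w] [c t].
rewrite /B12_change /B12_mul /=; congr pair.
  rewrite (form_expansion w t bxy) (form_expansion (_ + _) _ buv).
  have [-> ->] := form_change x y w buv.
  by have [-> ->] := form_change x y t buv.
rewrite linearDl linearD !linearZl_LR !linearZ /= !scalerDl !scalerDr !scalerA.
by rewrite addrACA.
Qed.

Lemma Gamma_change_basis (G : zmodType) x y u v (g : G) :
  b x y = 1 -> b u v = 1 ->
  isomorphic_gradings (Gamma b x y g) (Gamma b u v g).
Proof.
move=> bxy buv; pose f := linfun (B12_change x y u v).
have fE z : f z = B12_change x y u v z by rewrite lfunE.
(* As [f] is onto, with the reverse change of basis as inverse, an image is identified by a
   membership equivalence. *)
have imgE (U W : {vspace F^o * V}) :
    (forall z, (f z \in W) = (z \in U)) -> (f @: U)%VS = W.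
  move=> UW; apply/eqP; rewrite eqEsubv; apply/andP; split; apply/subvP.
    by move=> _ /memv_imgP[z zU ->]; rewrite UW.
  move=> z zW; have zE : z = f (B12_change u v x y z) by rewrite fE B12_changeK.
  by rewrite zE memv_img // -UW -zE.
have changeK := B12_changeK bxy buv.
exists f; split.
- by exists (B12_change u v x y) => z; rewrite fE B12_changeK.
- by move=> z w; rewrite !fE /=; apply: B12_changeM.
- move=> i; apply: imgE => z; rewrite !mem_B12_par fE /=.
  case: ifP => // _; apply/eqP/eqP => [z0|->]; last first.
    by rewrite linear0l linear0r !scale0r addr0.
  have [] := form_change x y z.2 buv; rewrite z0 linear0l linear0r => zy xz.
  by rewrite (symplectic_expansion z.2 bxy) -zy -xz !scale0r addr0.
move=> h; apply: imgE => z.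
rewrite (mem_Gamma _ _ _ b_alt (symplectic_basis buv) buv) fE /=.
rewrite (mem_Gamma _ _ _ b_alt (symplectic_basis bxy) bxy).
by have [-> ->] := form_change x y z.2 buv.
Qed.

(** The basis [v, - u] is again symplectic and lists the same two lines in the other order, with
    degrees [- g] and [- (- g) = g]. *)
Lemma GammaN (G : zmodType) u v (g h : G) :
  b u v = 1 -> Gamma b v (- u) (- g) h = Gamma b u v g h.
Proof.
move=> buv; have bvu : b v (- u) = 1 by rewrite linearN /= alternating_anti buv opprK.
apply/vspaceP => z.
rewrite (mem_Gamma _ _ _ b_alt (symplectic_basis buv) buv).
rewrite (mem_Gamma _ _ _ b_alt (symplectic_basis bvu) bvu).
by rewrite linearN /= -alternating_anti (alternating_anti z.2 v) oppr_eq0 opprK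
  [X in _ && X]andbC.
Qed.

Lemma isomorphic_Gamma_degree (G : zmodType) u v (g h : G) :
  b u v = 1 -> isomorphic_gradings (Gamma b u v g) (Gamma b u v h) ->
  g = h \/ g = - h.
Proof.
move=> buv [f [[f' fK _] _ fpar fGam]].
have memG := mem_Gamma _ _ _ b_alt (symplectic_basis buv) buv.
pose u1 : B12 b := (0, u).
have fu1 : f u1 \in salg_par (B12 b) 1.
  by rewrite -fpar memv_img // mem_B12_par /= eqxx.
have fug : f u1 \in Gamma b u v h g.
  by rewrite -fGam memv_img // memG /= b_alt !eqxx orbT.
have [->|gh] := eqVneq g h; first by left.
have [->|gNh] := eqVneq g (- h); first by right.
(* Oddness kills the scalar part of [f u1], and a degree other than [h] and [- h] kills both
   coordinates; injectivity then gives [u = 0]. *)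
have fu0 : f u1 = 0.
  move: fu1 fug; rewrite mem_B12_par memG /=.
  rewrite ![_ == g]eq_sym (negPf gh) (negPf gNh) !orbF.
  case: (f u1) => a w /= /eqP-> /and3P[_ /eqP wv /eqP uw].
  by rewrite (symplectic_expansion w buv) wv uw !scale0r addr0.
have := fK u1; rewrite fu0 -(linear0 f) fK => -[] u0.
by move: buv; rewrite -u0 linear0l => /esym/eqP; rewrite oner_eq0.
Qed.

(** * Homogeneous symplectic bases for an arbitrary grading *)

Section Homogeneous.
Variables (G : zmodType) (Gam : G -> {vspace B12 b}).
Hypothesis superG : is_super_grading Gam.

(** Some homogeneous component of [w] has a [V]-part on which [phi] is nonzero. Its odd part has the
    same [V]-part and stays in the same degree. *)
Lemma homogeneous_odd_nonzero (phi : {scalar V}) w :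
  phi w != 0 -> exists g x, ((0, x) : B12 b) \in Gam g /\ phi x != 0.
Proof.
case: superG => -[[s sGam] _ _] Gam_par phiw.
have : ((0, w) : B12 b) \in (\sum_(g <- s) Gam g)%VS by rewrite sGam memvf.
(* The induction runs over arbitrary pairs, since partial sums of components need not be odd. *)
move: phiw; have -> : w = (0 : F^o, w).2 by [].
move: (0 : F^o, w) => z {sGam}; elim: s z => [|g s IHs] z phiz.
  by rewrite big_nil memv0 => /eqP z0; rewrite z0 linear0 eqxx in phiz.
rewrite big_cons => /memv_addP[p pg [q qs zE]].
have [phip|phip] := eqVneq (phi p.2) 0.
  by apply: IHs qs; move: phiz; rewrite zE /= linearD /= phip add0r.
move: pg; rewrite Gam_par => /memv_addP[p0 + [p1 + pE]].
rewrite !memv_cap !mem_B12_par /= => /andP[_ /eqP p00] /andP[p1g /eqP p10].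
exists g, p1.2; split; last by move: phip; rewrite pE /= p00 add0r.
by move: p1g p10; case: (p1) => a y /= + a0; rewrite a0.
Qed.

Lemma homogeneous_symplectic_basis u v : b u v = 1 ->
  exists g x y, [/\ b x y = 1, ((0, x) : B12 b) \in Gam g,
    ((0, y) : B12 b) \in Gam (- g) & (B12_one V : B12 b) \in Gam 0].
Proof.
move=> buv.
(* The functional [b _ v], written as [- b v], is 1 at [u] and yields [x]; then [b x], nonzero at
   [v], yields [y], which is rescaled. *)
have [g [x [xg]]] : exists g x, ((0, x) : B12 b) \in Gam g /\ - b v x != 0.
  apply: (@homogeneous_odd_nonzero (\- b v)%R u) => /=.
  by rewrite -alternating_anti buv oner_eq0.
rewrite -alternating_anti => bxv.
have [h [y [yh bxy]]] := homogeneous_odd_nonzero bxv.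
pose y1 := (b x y)^-1 *: y.
have y1h : ((0, y1) : B12 b) \in Gam h.
  have -> : (0, y1) = (b x y)^-1 *: ((0, y) : B12 b).
    by congr pair; rewrite /= scaler0.
  exact: memvZ.
have bxy1 : b x y1 = 1 by rewrite linearZ /= mulVf.
case: superG => gradG _; have [_ _ GamM] := gradG.
have one_gh : (B12_one V : B12 b) \in Gam (g + h).
  have := GamM _ _ _ _ xg y1h; rewrite /= /B12_mul /= bxy1 mul0r add0r.
  by rewrite !scale0r addr0.
have one_2gh : (B12_one V : B12 b) \in Gam ((g + h) + (g + h)).
  have := GamM _ _ _ _ one_gh one_gh; rewrite /= /B12_mul /= linear0l mul1r addr0.
  by rewrite scaler0 addr0.
have one_neq0 : (B12_one V : B12 b) != 0.
  by apply/eqP=> -[] /eqP; rewrite oner_eq0.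
have gh0 : g + h = 0.
  apply: (addrI (g + h)); rewrite addr0.
  exact: grading_degree_unique gradG one_neq0 one_2gh one_gh.
have hE : h = - g by apply/eqP; rewrite -addr_eq0 addrC gh0.
by exists g, x, y1; split; rewrite // -?hE -?gh0.
Qed.

Lemma super_grading_Gamma u v : b u v = 1 ->
  exists g x y, b x y = 1 /\ forall h, Gam h = Gamma b x y g h.
Proof.
move=> /homogeneous_symplectic_basis[g [x [y [bxy xg yg one0]]]].
exists g, x, y; split=> //; case: superG => gradG _.
have [gradxy _] := Gamma_is_super_grading g b_alt (symplectic_basis bxy) bxy.
apply: grading_sub_eq gradG gradxy _ => h; apply/span_subvP => _ /mapP[e + ->].
by rewrite mem_filter !inE => /andP[/eqP<- /or3P[] /eqP->].
Qed.

End Homogeneous.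

End B12Gradings.

Theorem theorem13 (F : fieldType) (charF : 3%N \in [pchar F])
  (G : zmodType) (V : vectType F) (dimV : \dim {:V} = 2%N)
  (b : {biscalar V}) (b_alt : alternating b) (b_nondeg : nondegenerate_form b)
  (u v : V) (uv_basis : basis_of {:V} [:: u; v]) (b_uv : b u v = 1) :
  (forall Gam : G -> {vspace (B12 b)},
     is_super_grading Gam ->
     exists g : G, isomorphic_gradings Gam (Gamma b u v g)) /\
  (forall g h : G,
     isomorphic_gradings (Gamma b u v g) (Gamma b u v h) <->
     g = h \/ g = - h).
Proof.
split=> [Gam superG|g h].
  have [g [x [y [bxy GamE]]]] := super_grading_Gamma dimV b_alt superG b_uv.
  have [f [fbij fM fpar fGam]] := Gamma_change_basis dimV b_alt g bxy b_uv.
  by exists g, f; split=> // h; rewrite GamE.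
split; first exact: isomorphic_Gamma_degree.
(* Reflexivity is the change from [u, v] to itself. For [g = - h], the change to [v, - u] lands in a
   grading that [GammaN] identifies. *)
case=> ->; first exact: Gamma_change_basis.
have bvu : b v (- u) = 1.
  by rewrite linearN /= (alternating_anti b_alt u) b_uv opprK.
have [f [fbij fM fpar fGam]] := Gamma_change_basis dimV b_alt (- h) b_uv bvu.
by exists f; split=> // k; rewrite fGam GammaN.
Qed.
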